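(* For $t\in\mathbb{R}$ and $|q|<1$, \[ \sum_{n=0}^{\infty}\frac{q^{n^2}}{(tq;q^2)_n}=1+ \sum_{n=1}^{\infty}t^{n-1}q^n(-q^2/t;q^2)_{n-1}. \]
   Context: For $x\in\mathbb{C}$, $(x;q^2)_n=\prod_{j=0}^{n-1}(1-xq^{2j})$, with $(x;q^2)_0=1$.
   Formalization: The condition |tq|<1 is added, since for |tq|≥1 the right-hand series diverges (and the left can have a zero denominator, e.g. t=2, q=1/2); at t=0 the product t^{n-1}(-q^2/t;q^2)_{n-1} is read as its continuous extension q^{n(n-1)}. *)

(* Defs.v *)
From Stdlib Require Import Reals Lra Lia.
From Coquelicot Require Import Coquelicot.

Open Scope R_scope.
Open Scope C_scope.

(* (x; p)_n, to be used at base p = q ^ 2. *)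
Fixpoint qpoch (x p : C) (n : nat) : C :=
  match n with
  | O => 1
  | S m => qpoch x p m * (1 - x * p ^ m)
  end.

(* t^m (-q^2/t; q^2)_m.  The expression -q^2/t is undefined at t = 0, where
   the polynomial prod_(1 <= j <= m) (t + q^(2 j)) (see [tpoch_S]) gives the
   continuous extension q^(2 + 4 + ... + 2 m) = q^(m (m + 1)). *)
Definition tpoch (t : R) (q : C) (m : nat) : C :=
  if Req_EM_T t 0 then q ^ (m * (m + 1))
  else RtoC t ^ m * qpoch (- q ^ 2 / RtoC t) (q ^ 2) m.

Lemma tpoch_S (t : R) (q : C) (m : nat) :
  tpoch t q (S m) = tpoch t q m * (RtoC t + q ^ (2 * (m + 1))).
Proof.
unfold tpoch; destruct (Req_EM_T t 0) as [-> | ht].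
- replace (S m * (S m + 1))%nat with (m * (m + 1) + 2 * (m + 1))%nat by lia.
  rewrite Cpow_add_r; ring.
- assert (ht' : RtoC t <> 0) by (intro e; apply ht; now injection e).
  replace (2 * (m + 1))%nat with (2 + 2 * m)%nat by lia.
  rewrite Cpow_add_r, (Cpow_mult_r q 2 m).
  change (qpoch ?x ?p (S m)) with (qpoch x p m * (1 - x * p ^ m)).
  rewrite Cpow_S; field; exact ht'.
Qed.

Lemma qpoch_neq0 (t : R) (q : C) (n : nat) :
  (Cmod q < 1)%R -> (Cmod (RtoC t * q) < 1)%R ->
  qpoch (RtoC t * q) (q ^ 2) n <> 0.
Proof.
intros hq htq; induction n as [|n IH].
- intro e; injection e; lra.
- change (qpoch ?x ?p (S n)) with (qpoch x p n * (1 - x * p ^ n)).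
  apply Cmult_neq_0; [exact IH|]; intro e.
  assert (e1 : RtoC t * q * (q ^ 2) ^ n = 1).
  { replace (RtoC t * q * (q ^ 2) ^ n)
      with (1 - (1 - RtoC t * q * (q ^ 2) ^ n)) by ring.
    rewrite e; ring. }
  apply (f_equal Cmod) in e1.
  rewrite Cmod_mult, <- Cpow_mult_r, Cmod_pow, Cmod_1 in e1.
  assert (h0 := Cmod_ge_0 q); assert (h1 := Cmod_ge_0 (RtoC t * q)).
  assert (h2 : (0 <= Cmod q ^ (2 * n) <= 1)%R).
  { split; [now apply pow_le|].
    rewrite <- (pow1 (2 * n)); apply pow_incr; lra. }
  nra.
Qed.

(* The region |t q| < 1 is exactly the region of convergence of the right-hand
   side. *)
Lemma rhs_diverges (t : R) (q : C) :
  (Cmod q < 1)%R -> (1 <= Cmod (RtoC t * q))%R ->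
  ~ ex_series (fun k : nat => tpoch t q k * q ^ (k + 1)).
Proof.
intros hq htq [l hl].
set (a := fun k : nat => tpoch t q k * q ^ (k + 1)).
set (r := Cmod q).
assert (hr0 : (0 < r)%R).
{ destruct (Rle_lt_or_eq_dec 0 r (Cmod_ge_0 q)) as [h|h]; [exact h|].
  unfold r in h; rewrite Cmod_mult, <- h in htq; lra. }
assert (hstep : forall k, ((1 - r ^ k) * Cmod (a k) <= Cmod (a (S k)))%R).
{ intro k; unfold a.
  rewrite tpoch_S.
  replace (tpoch t q k * (RtoC t + q ^ (2 * (k + 1))) * q ^ (S k + 1))
    with (tpoch t q k * q ^ (k + 1) * (RtoC t * q + q ^ (2 * (k + 1) + 1)))
    by (change (S k + 1)%nat with (S (k + 1));
        rewrite (Cpow_S q (k + 1)), (Cpow_add_r q (2 * (k + 1)) 1), Cpow_1_r; ring).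
  rewrite (Cmod_mult (tpoch t q k * q ^ (k + 1))), Rmult_comm.
  apply Rmult_le_compat_l; [apply Cmod_ge_0|].
  assert (h := Cmod_triangle (RtoC t * q + q ^ (2 * (k + 1) + 1))
                             (- q ^ (2 * (k + 1) + 1))).
  replace (RtoC t * q + q ^ (2 * (k + 1) + 1) + - q ^ (2 * (k + 1) + 1))
    with (RtoC t * q) in h by ring.
  rewrite Cmod_opp, Cmod_pow in h; fold r in h.
  assert (h2 : (r ^ (2 * (k + 1) + 1) <= r ^ k)%R).
  { replace (2 * (k + 1) + 1)%nat with (k + (k + 3))%nat by lia.
    rewrite pow_add.
    assert (h3 : (0 < r ^ k)%R) by now apply pow_lt.
    assert (h4 : (r ^ (k + 3) <= 1)%R).
    { rewrite <- (pow1 (k + 3)); apply pow_incr; unfold r in *; lra. }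
    nra. }
  lra. }
assert (hpos : forall k, (0 < Cmod (a k))%R).
{ assert (hp1 : forall k, (0 < k)%nat -> (r ^ k < 1)%R).
  { intros k hk; apply pow_lt_1_compat; [unfold r in *; lra | exact hk]. }
  assert (ha0 : (0 < Cmod (a 0%nat))%R).
  { unfold a, tpoch; simpl.
    destruct (Req_EM_T t 0); rewrite ?Cmult_1_r, ?Cmult_1_l; exact hr0. }
  assert (ha1 : (0 < Cmod (a 1%nat))%R).
  { unfold a; rewrite tpoch_S.
    replace (tpoch t q 0) with (RtoC 1)
      by (unfold tpoch; destruct (Req_EM_T t 0); simpl; ring).
    replace (1 * (RtoC t + q ^ (2 * (0 + 1))) * q ^ (1 + 1))
      with (q * (RtoC t * q + q ^ 3)) by (simpl; ring).
    rewrite Cmod_mult; apply Rmult_lt_0_compat; [exact hr0|].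
    assert (h := Cmod_triangle (RtoC t * q + q ^ 3) (- q ^ 3)).
    replace (RtoC t * q + q ^ 3 + - q ^ 3) with (RtoC t * q) in h by ring.
    rewrite Cmod_opp, Cmod_pow in h; fold r in h.
    assert (h3 := hp1 3%nat ltac:(lia)); lra. }
  intro k; destruct k as [|k]; [exact ha0|].
  induction k as [|k IH]; [exact ha1|].
  eapply Rlt_le_trans; [|apply hstep].
  apply Rmult_lt_0_compat; [|exact IH].
  assert (h := hp1 (S k) ltac:(lia)); lra. }
assert (hN : exists N, (r ^ N < (1 - r) / 2)%R).
{ destruct (pow_lt_1_zero r) with (y := ((1 - r) / 2)%R) as [N h].
  - rewrite Rabs_pos_eq; unfold r in *; lra.
  - unfold r in *; lra.
  - exists N; assert (h' := h N (le_n N)).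
    rewrite Rabs_pos_eq in h'; [exact h'|]; apply pow_le; lra. }
destruct hN as [N hN].
assert (hlow : forall k, (Cmod (a N) * (1 - (r ^ N - r ^ (N + k)) / (1 - r))
                          <= Cmod (a (N + k)%nat))%R).
{ assert (h1r : (0 < 1 - r)%R) by (unfold r in *; lra).
  induction k as [|k IH].
  - rewrite Nat.add_0_r; right; field; lra.
  - rewrite <- plus_n_Sm.
    eapply Rle_trans; [|apply hstep].
    set (u := (r ^ N)%R) in *; set (v := (r ^ (N + k))%R) in *.
    assert (hv : (0 < v)%R) by now apply pow_lt.
    assert (hv1 : (v <= 1)%R).
    { unfold v; rewrite <- (pow1 (N + k)); apply pow_incr; unfold r in *; lra. }
    assert (hvu : (v <= u)%R).
    { unfold v, u; rewrite pow_add.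
      assert (h3 : (0 < r ^ N)%R) by now apply pow_lt.
      assert (h4 : (r ^ k <= 1)%R).
      { rewrite <- (pow1 k); apply pow_incr; unfold r in *; lra. }
      nra. }
    change (r ^ S (N + k))%R with (r * v)%R.
    replace (1 - (u - r * v) / (1 - r))%R with (1 - (u - v) / (1 - r) - v)%R
      by (field; lra).
    eapply Rle_trans;
      [|apply Rmult_le_compat_l; [lra | exact IH]].
    assert (hN0 := hpos N).
    assert (hd : (0 <= (u - v) / (1 - r))%R) by (apply Rdiv_le_0_compat; lra).
    set (d := ((u - v) / (1 - r))%R) in *.
    assert (h5 : (0 <= v * d)%R) by now apply Rmult_le_pos; [lra|].
    assert (h6 : (0 <= Cmod (a N) * (v * d))%R) by (apply Rmult_le_pos; lra).
    nra. }
assert (hhalf : forall k, (Cmod (a N) / 2 <= Cmod (a (N + k)%nat))%R).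
{ intro k; eapply Rle_trans; [|apply hlow].
  assert (hN0 := hpos N).
  assert (h1r : (0 < 1 - r)%R) by (unfold r in *; lra).
  assert (h3 : (0 < r ^ (N + k))%R) by now apply pow_lt.
  assert (h4 : ((r ^ N - r ^ (N + k)) / (1 - r) <= 1 / 2)%R).
  { apply Rle_div_l; lra. }
  nra. }
assert (hc : @Cauchy_series C_AbsRing C_NormedModule a) by (apply (@Cauchy_ex_series C_AbsRing C_CompleteNormedModule); exists l; exact hl).
assert (he : (0 < Cmod (a N) / 2)%R) by (assert (h := hpos N); lra).
destruct (hc (mkposreal _ he)) as [M hM].
specialize (hM (N + M)%nat (N + M)%nat ltac:(lia) ltac:(lia)).
rewrite sum_n_n in hM.
change (Cmod (a (N + M)%nat) < Cmod (a N) / 2)%R in hM.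
specialize (hhalf M); lra.
Qed.

(* Main.v *)
(** Put [z = t q], [p = q^2] and [a_k = q^(k+1) (t + p) ... (t + p^k)], so that
    [a_(k+1) = (z + q^3 p^k) a_k].  The moments [h_n = sum_k p^(n k) a_k] then
    satisfy [(1 - z p^n) h_n = q + q^(2n+3) h_(n+1)].  Iterating from [n = 0]
    peels off the terms of the left-hand series one at a time and leaves the
    remainder [q^(n (n + 2)) / (z; p)_n * h_n], which tends to zero because
    the [h_n] are bounded. *)

Require Import Defs.
From Stdlib Require Import Reals Lra Lia.
From Coquelicot Require Import Coquelicot.

Local Open Scope C_scope.

(** From index [K] on, the terms are dominated by the geometric sequence [u K * rho ^ n]. Stating
    the ratio test without division lets it apply to sequences with zero terms. *)
Lemma ex_series_eventually_ratio_le (u : nat -> R) (rho : R) (K : nat) :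
  (forall n, 0 <= u n)%R -> (0 <= rho < 1)%R ->
  (forall n, (K <= n)%nat -> (u (S n) <= rho * u n)%R) ->
  ex_series u.
Proof.
intros hu hrho hstep.
apply (ex_series_incr_n u K).
apply (@ex_series_le R_AbsRing R_CompleteNormedModule _
         (fun n => scal (u K) (rho ^ n)%R)).
- intro n; change (Rabs (u (K + n)%nat) <= u K * rho ^ n)%R.
  rewrite Rabs_pos_eq by apply hu.
  induction n as [|n IH].
  + rewrite Nat.add_0_r; simpl; lra.
  + rewrite <- plus_n_Sm.
    eapply Rle_trans; [apply hstep; lia|].
    simpl; nra.
- apply @ex_series_scal, ex_series_geom.
  rewrite Rabs_pos_eq; lra.
Qed.

Lemma eventually_pow_lt (r eps : R) :
  (0 <= r < 1)%R -> (0 < eps)%R ->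
  exists K : nat, forall n, (K <= n)%nat -> (r ^ n < eps)%R.
Proof.
intros hr heps.
destruct (pow_lt_1_zero r) with (y := eps) as [K hK];
  [rewrite Rabs_pos_eq; lra | lra |].
exists K; intros n hn.
specialize (hK n hn).
rewrite Rabs_pos_eq in hK; [exact hK | now apply pow_le].
Qed.

Lemma pow_le_1 (r : R) (n : nat) : (0 <= r <= 1)%R -> (0 <= r ^ n <= 1)%R.
Proof.
intro hr; split; [now apply pow_le|].
rewrite <- (pow1 n); now apply pow_incr.
Qed.

(** The ratio [z + q ^ (2 * k + 3)] tends to [z], so its modulus is eventually at most the midpoint
    of [Cmod z] and 1. *)
Lemma ex_series_Cmod_ratio (a : nat -> C) (z q : C) :
  (Cmod q < 1)%R -> (Cmod z < 1)%R ->
  (forall k, a (S k) = (z + q ^ (2 * k + 3)) * a k) ->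
  ex_series (fun k => Cmod (a k)).
Proof.
intros hq hz ha.
assert (hq0 := Cmod_ge_0 q); assert (hz0 := Cmod_ge_0 z).
destruct (eventually_pow_lt (Cmod q) ((1 - Cmod z) / 2)) as [K hK]; [lra.. |].
apply (ex_series_eventually_ratio_le _ ((1 + Cmod z) / 2) K).
- intro; apply Cmod_ge_0.
- lra.
- intros n hn; rewrite ha, Cmod_mult.
  apply Rmult_le_compat_r; [apply Cmod_ge_0|].
  eapply Rle_trans; [apply Cmod_triangle|].
  rewrite Cmod_pow.
  specialize (hK (2 * n + 3)%nat ltac:(lia)); lra.
Qed.

Lemma Cmod_1_minus_ge (z w : C) :
  (Cmod w <= 1)%R -> (1 - Cmod z <= Cmod (1 - z * w))%R.
Proof.
intro hw.
assert (h := Cmod_triangle (1 - z * w) (z * w)).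
replace (1 - z * w + z * w) with (RtoC 1) in h by ring.
rewrite Cmod_1, (Cmod_mult z w) in h.
assert (h0 := Cmod_ge_0 z); nra.
Qed.

(** Consecutive terms have ratio [q ^ (2 * n + 3) / (1 - z * (q ^ 2) ^ n)]. Its denominator stays at
    least [1 - Cmod z] in modulus while its numerator decays, so the moduli are even summable. *)
Lemma is_lim_seq_pow_div_qpoch (z q : C) :
  (Cmod q < 1)%R -> (Cmod z < 1)%R ->
  (forall n, qpoch z (q ^ 2) n <> 0) ->
  is_lim_seq (fun n => Cmod (q ^ (n * (n + 2)) / qpoch z (q ^ 2) n)) 0.
Proof.
intros hq hz hne.
assert (hq0 := Cmod_ge_0 q); assert (hz0 := Cmod_ge_0 z).
(* Half the lower bound [1 - Cmod z] of the denominator, which makes the ratio at most 1/2. *)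
destruct (eventually_pow_lt (Cmod q) ((1 - Cmod z) / 2)) as [K hK]; [lra.. |].
apply ex_series_lim_0, (ex_series_eventually_ratio_le _ (1 / 2) K).
- intro; apply Cmod_ge_0.
- lra.
- intros n hn.
  assert (hS := hne (S n)).
  change (qpoch z (q ^ 2) (S n))
    with (qpoch z (q ^ 2) n * (1 - z * (q ^ 2) ^ n)) in *.
  assert (hd : 1 - z * (q ^ 2) ^ n <> 0) by (intro e; apply hS; rewrite e; ring).
  replace (S n * (S n + 2))%nat with (2 * n + 3 + n * (n + 2))%nat by lia.
  rewrite Cpow_add_r.
  replace (q ^ (2 * n + 3) * q ^ (n * (n + 2)) /
             (qpoch z (q ^ 2) n * (1 - z * (q ^ 2) ^ n)))
    with (q ^ (2 * n + 3) / (1 - z * (q ^ 2) ^ n) *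
            (q ^ (n * (n + 2)) / qpoch z (q ^ 2) n))
    by (field; split; [exact hd | apply hne]).
  rewrite Cmod_mult.
  apply Rmult_le_compat_r; [apply Cmod_ge_0|].
  rewrite Cmod_div by exact hd.
  assert (hlow : (1 - Cmod z <= Cmod (1 - z * (q ^ 2) ^ n))%R).
  { apply Cmod_1_minus_ge.
    rewrite <- Cpow_mult_r, Cmod_pow; apply pow_le_1; lra. }
  apply Rle_div_l; [lra|].
  rewrite Cmod_pow.
  specialize (hK (2 * n + 3)%nat ltac:(lia)); lra.
Qed.

Lemma is_series_C_unique (a : nat -> C) (l1 l2 : C) :
  is_series a l1 -> is_series a l2 -> l1 = l2.
Proof. exact (@filterlim_locally_unique _ C_AbsRing C_NormedModule _ _ _ l1 l2). Qed.

Lemma Cmod_is_series_le (a : nat -> C) (b : nat -> R) (l : C) (B : R) :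
  (forall n, Cmod (a n) <= b n)%R -> is_series a l -> is_series b B ->
  (Cmod l <= B)%R.
Proof.
intros hab ha hb.
apply (is_lim_seq_le (fun n => Cmod (sum_n a n)) (sum_n b) (Cmod l) B).
- intro n; eapply Rle_trans;
    [exact (@norm_sum_n_m C_AbsRing C_NormedModule a 0 n)|].
  apply sum_n_m_le; exact hab.
- exact (filterlim_comp _ _ _ _ _ _ _ _ ha
           (@filterlim_norm C_AbsRing C_NormedModule l)).
- exact hb.
Qed.

(** The moment series with its first term dropped is summed in two ways: as [h - q], and through the
    recurrence for [a]. *)
Lemma moment_rec (z q : C) (a : nat -> C) (n : nat) (h h' : C) :
  a 0%nat = q -> (forall k, a (S k) = (z + q ^ (2 * k + 3)) * a k) ->
  is_series (fun k => q ^ (2 * n * k) * a k) h ->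
  is_series (fun k => q ^ (2 * S n * k) * a k) h' ->
  (1 - z * (q ^ 2) ^ n) * h = q + q ^ (2 * n + 3) * h'.
Proof.
intros a_0 a_S hh hh'.
assert (shifted : is_series (fun k => q ^ (2 * n * S k) * a (S k)) (h - q)).
{ apply (@is_series_incr_1 C_AbsRing C_NormedModule
           (fun k => q ^ (2 * n * k) * a k) (h - q)).
  change (is_series (fun k => q ^ (2 * n * k) * a k)
            (h - q + q ^ (2 * n * 0) * a 0%nat)).
  rewrite a_0, Nat.mul_0_r.
  replace (h - q + q ^ 0 * q) with h by (simpl; ring); exact hh. }
assert (split : is_series (fun k => q ^ (2 * n * S k) * a (S k))
                  (z * q ^ (2 * n) * h + q ^ (2 * n + 3) * h')).
(* The factor [q ^ (2 * k)] in the second part of [a (S k)] raises the order of the moment from [n]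
   to [S n]. *)
{ apply (is_series_ext
           (fun k => plus (scal (z * q ^ (2 * n)) (q ^ (2 * n * k) * a k))
                          (scal (q ^ (2 * n + 3)) (q ^ (2 * S n * k) * a k)))).
  - intro k; rewrite a_S.
    change (z * q ^ (2 * n) * (q ^ (2 * n * k) * a k)
            + q ^ (2 * n + 3) * (q ^ (2 * S n * k) * a k)
            = q ^ (2 * n * S k) * ((z + q ^ (2 * k + 3)) * a k)).
    replace (2 * n * S k)%nat with (2 * n + 2 * n * k)%nat by lia.
    replace (2 * S n * k)%nat with (2 * k + 2 * n * k)%nat by lia.
    rewrite !Cpow_add_r; ring.
  - exact (@is_series_plus C_AbsRing C_NormedModule _ _ _ _
             (@is_series_scal C_AbsRing C_NormedModule _ _ _ hh)
             (@is_series_scal C_AbsRing C_NormedModule _ _ _ hh')). }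
assert (e := is_series_C_unique _ _ _ shifted split).
rewrite <- Cpow_mult_r.
transitivity (q + (h - q) - z * q ^ (2 * n) * h); [ring|].
rewrite e; ring.
Qed.

(** The identity with its exact remainder, before any limit is taken. In the induction step
    [moment_rec] rewrites the remainder, and its part coming from [q] cancels against the new term
    of the sum. *)
Lemma partial_sum_moment (z q : C) (a : nat -> C) (n : nat) (r h : C) :
  a 0%nat = q -> (forall k, a (S k) = (z + q ^ (2 * k + 3)) * a k) ->
  (forall m, ex_series (fun k => q ^ (2 * m * k) * a k)) ->
  (forall m, qpoch z (q ^ 2) m <> 0) ->
  is_series a r -> is_series (fun k => q ^ (2 * n * k) * a k) h ->
  sum_n (fun m => q ^ (m ^ 2) / qpoch z (q ^ 2) m) n
  = 1 + r - q ^ (n * (n + 2)) / qpoch z (q ^ 2) n * h.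
Proof.
intros a_0 a_S hex hne hr; revert h.
induction n as [|n IH]; intros h' hh'.
(* The moment of order 0 is the sum of [a] itself, so the claim reads 1 = 1 + r - r. *)
- assert (e : h' = r).
  { apply (is_series_C_unique a); [|exact hr].
    refine (is_series_ext _ _ _ _ hh'); intro k; simpl; ring. }
  rewrite sum_O, e.
  change (1 / 1 = 1 + r - 1 / 1 * r); field; intro e1; injection e1; lra.
- destruct (hex n) as [h hh]; change C in h.
  rewrite sum_Sn, (IH h hh).
  assert (hS := hne (S n)).
  assert (e := moment_rec z q a n _ _ a_0 a_S hh hh').
  change (qpoch z (q ^ 2) (S n))
    with (qpoch z (q ^ 2) n * (1 - z * (q ^ 2) ^ n)) in *.
  assert (hd : 1 - z * (q ^ 2) ^ n <> 0) by (intro e0; apply hS; rewrite e0; ring).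
  set (d := 1 - z * (q ^ 2) ^ n) in *.
  assert (eh : h = (q + q ^ (2 * n + 3) * h') / d :> C)
    by (rewrite <- e; field; exact hd).
  rewrite eh.
  change (1 + r - q ^ (n * (n + 2)) / qpoch z (q ^ 2) n *
            ((q + q ^ (2 * n + 3) * h') / d)
          + q ^ (S n ^ 2) / (qpoch z (q ^ 2) n * d)
          = 1 + r
            - q ^ (S n * (S n + 2)) / (qpoch z (q ^ 2) n * d) * h' :> C).
  (* The first exponent produces the cancellation with [q]; the second is that of the next
     remainder. *)
  replace (S n ^ 2)%nat with (1 + n * (n + 2))%nat by (simpl; lia).
  replace (S n * (S n + 2))%nat with (2 * n + 3 + n * (n + 2))%nat by lia.
  rewrite (Cpow_add_r q 1 (n * (n + 2))), (Cpow_add_r q (2 * n + 3) (n * (n + 2))),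
    Cpow_1_r.
  field; split; [exact hd | apply hne].
Qed.

Lemma is_series_pow_div_qpoch (z q : C) (a : nat -> C) :
  (Cmod q < 1)%R -> (Cmod z < 1)%R -> (forall n, qpoch z (q ^ 2) n <> 0) ->
  a 0%nat = q -> (forall k, a (S k) = (z + q ^ (2 * k + 3)) * a k) ->
  exists r : C,
    is_series (fun n => q ^ (n ^ 2) / qpoch z (q ^ 2) n) (1 + r) /\
    is_series a r.
Proof.
intros hq hz hne a_0 a_S.
assert (hq0 := Cmod_ge_0 q).
destruct (ex_series_Cmod_ratio a z q hq hz a_S) as [B hB].
(* One summable majorant serves all orders [n], so [B] bounds every moment uniformly. *)
assert (hle : forall n k, (Cmod (q ^ (2 * n * k) * a k) <= Cmod (a k))%R).
{ intros n k; rewrite Cmod_mult, Cmod_pow.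
  assert (h1 := pow_le_1 (Cmod q) (2 * n * k) ltac:(lra)).
  assert (h2 := Cmod_ge_0 (a k)); nra. }
assert (hex : forall n, ex_series (fun k => q ^ (2 * n * k) * a k)).
{ intro n.
  apply (@ex_series_le C_AbsRing C_CompleteNormedModule _ (fun k => Cmod (a k)));
    [apply hle | exists B; exact hB]. }
destruct (hex 0%nat) as [r hr0]; change C in r.
assert (hr : is_series a r)
  by (refine (is_series_ext _ _ _ _ hr0); intro k; simpl; ring).
exists r; split; [|exact hr].
apply (@filterlim_locally_ball_norm C_AbsRing); [typeclasses eauto|].
intro eps.
assert (hB0 : (0 <= B)%R).
{ eapply Rle_trans; [apply (Cmod_ge_0 r)|].
  apply (Cmod_is_series_le a (fun k => Cmod (a k))); auto; intro; lra. }
(* [B + 1] replaces [B] because [B] vanishes when [q = 0]. *)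
assert (he : (0 < eps / (B + 1))%R)
  by (apply Rdiv_lt_0_compat; [apply cond_pos | lra]).
assert (hlim := is_lim_seq_pow_div_qpoch z q hq hz hne).
apply is_lim_seq_spec in hlim.
destruct (hlim (mkposreal _ he)) as [N hN].
exists N; intros n hn.
specialize (hN n hn); cbn [pos] in hN.
destruct (hex n) as [h hh]; change C in h.
change (Cmod (sum_n (fun m => q ^ (m ^ 2) / qpoch z (q ^ 2) m)%C n - (1 + r))
        < eps)%R.
rewrite (partial_sum_moment z q a n r h a_0 a_S hex hne hr hh).
set (w := q ^ (n * (n + 2)) / qpoch z (q ^ 2) n) in *.
replace (1 + r - w * h - (1 + r)) with (- (w * h)) by ring.
rewrite Cmod_opp, Cmod_mult.
assert (hhB : (Cmod h <= B)%R)
  by (apply (Cmod_is_series_le _ (fun k => Cmod (a k)) _ _ (hle n) hh hB)).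
rewrite Rminus_0_r, Rabs_pos_eq in hN by apply Cmod_ge_0.
apply Rlt_div_r in hN; [|lra].
assert (h1 := Cmod_ge_0 w); assert (h2 := Cmod_ge_0 h); nra.
Qed.

(** The right-hand series is indexed by [k = n - 1], hence the exponent [k + 1]. *)
Theorem theorem1p6 (t : R) (q : C) (hq : (Cmod q < 1)%R)
    (htq : (Cmod (RtoC t * q) < 1)%R) :
  exists l r : C,
    is_series (fun n : nat => (q ^ (n ^ 2) / qpoch (RtoC t * q) (q ^ 2) n)%C) l /\
    is_series (fun k : nat => (tpoch t q k * q ^ (k + 1))%C) r /\
    l = (1 + r)%C.
Proof.
destruct (is_series_pow_div_qpoch (RtoC t * q) q
            (fun k => tpoch t q k * q ^ (k + 1))) as [r [hl hr]].
- exact hq.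
- exact htq.
- intro n; exact (qpoch_neq0 t q n hq htq).
- unfold tpoch; destruct (Req_EM_T t 0); simpl; ring.
(* The new factor of [tpoch] times the extra [q] is [t * q + q ^ (2 * k + 3)], the required ratio
   with [z = t * q]. *)
- intro k; rewrite tpoch_S.
  replace (S k + 1)%nat with (1 + (k + 1))%nat by lia.
  replace (2 * k + 3)%nat with (2 * (k + 1) + 1)%nat by lia.
  rewrite (Cpow_add_r q 1 (k + 1)), (Cpow_add_r q (2 * (k + 1)) 1), Cpow_1_r; ring.
- exists (1 + r), r; auto.
Qed.
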